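(* Let $(X,d_X)$ and $(Y,d_Y)$ be nonempty metric spaces and let $\Phi:X\to Y$ be a weak similarity. Then $\Phi$ is a uniform equivalence if and only if the equivalence $$0\in\mathrm{ac}(D(X))\ \Leftrightarrow\ 0\in\mathrm{ac}(D(Y))$$ holds.
   Context: The distance set of a nonempty metric space is $D(X)=\{d(x,y):x,y\in X\}$. A surjective mapping $\Phi:X\to Y$ between nonempty metric spaces is a weak similarity if there is a strictly increasing function $f:D(Y)\to D(X)$ such that $d_X(x,y)=f(d_Y(\Phi(x),\Phi(y)))$ for all $x,y\in X$. A uniformly continuous mapping $F:X\to Y$ is a uniform equivalence if it is bijective and its inverse $F^{-1}:Y\to X$ is also uniformly continuous. For $A\subseteq[0,\infty)$, $\mathrm{ac}(A)$ is the set of all accumulation points of $A$ in $[0,\infty)$ with the standard topology. *)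

(* Defs.v *)
From HB Require Import structures.
From mathcomp Require Import all_boot all_order all_algebra.
From mathcomp Require Import all_classical all_reals all_analysis.

Set Implicit Arguments.
Unset Strict Implicit.
Unset Printing Implicit Defensive.

Import Order.TTheory GRing.Theory Num.Theory.
Import numFieldNormedType.Exports.

Local Open Scope classical_set_scope.
Local Open Scope ring_scope.

Definition distance_set (R : realType) (X : metricType R) : set R :=
  [set mdist p.1 p.2 | p in [set: X * X]].

(* The type [subspace `[0, +oo[] has carrier R, with the subspace topology on
   [0, +oo[ and every point outside isolated, so that the points of [ac A] are
   exactly the accumulation points in the space [0, +oo[. *)
Definition ac (R : realType) (A : set R) : set R :=
  @limit_point (subspace (`[0, +oo[%classic : set R)) A.

(* A function D(Y) -> D(X) is given by a total [f : R -> R] mapping D(Y) into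
   D(X); the values of [f] outside D(Y) play no role. *)
Definition weak_similarity (R : realType) (X Y : metricType R)
    (Phi : X -> Y) : Prop :=
  set_surj [set: X] [set: Y] Phi /\
  exists f : R -> R,
    [/\ set_fun (distance_set Y) (distance_set X) f,
        {in distance_set Y &, {homo f : s t / s < t}} &
        forall x y : X, mdist x y = f (mdist (Phi x) (Phi y))].

Definition uniform_equivalence (R : realType) (X Y : metricType R)
    (F : X -> Y) : Prop :=
  unif_continuous F /\
  exists G : Y -> X, [/\ cancel F G, cancel G F & unif_continuous G].

(* Main.v *)
(** A weak similarity is injective and preserves and reflects the strict order of
    distances.  If 0 is an accumulation point of [D(Y)], then any distance
    [0 < d(Phi x, Phi y) < e] yields the modulus [d(x, y)] for [e], since
    [Phi] preserves the order; if 0 is isolated in [D(X)], then [X] is uniformly discrete and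
    every map on [X] is uniformly continuous.  Conversely, an injective uniformly
    continuous map sends small positive distances to small positive distances. *)

Require Import Defs.
From HB Require Import structures.
From mathcomp Require Import all_boot all_order all_algebra.
From mathcomp Require Import all_classical all_reals all_analysis.

Set Implicit Arguments.
Unset Strict Implicit.
Unset Printing Implicit Defensive.

Import Order.TTheory GRing.Theory Num.Theory.
Import numFieldNormedType.Exports.

Local Open Scope classical_set_scope.
Local Open Scope ring_scope.

(** Distances are nonnegative, so a neighbourhood of 0 within [[0, +oo[] only has to bound them from
    above. *)
Lemma ac_distance_set0P (R : realType) (X : metricType R) :
  ac (distance_set X) 0 <->
  forall e : R, 0 < e -> exists x y : X, 0 < mdist x y < e.
Proof.
have in0 : `[0, +oo[%classic (0 : R) by rewrite /= in_itv /= lexx.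
(* As 0 lies in [[0, +oo[], it is not one of the artificially isolated points of the subspace
   type. *)
have nbhs0E : nbhs (0 : subspace (`[0, +oo[%classic : set R)) =
    within `[0, +oo[%classic (nbhs (0 : R)).
  by symmetry; apply: (@nbhs_subspace_in R `[0, +oo[%classic 0).
split=> [acX e e0|small U].
  have nU : nbhs (0 : subspace (`[0, +oo[%classic : set R)) [set t | t < e].
    rewrite nbhs0E /within /=.
    by near=> t => _; near: t; exact: lt_nbhsl.
  have [t [t0 [[x y] _ /= xyt] /= te]] := acX _ nU.
  by exists x, y; rewrite xyt te lt_neqAle eq_sym t0 -xyt mdist_ge0.
rewrite nbhs0E /within /= => /nbhs_ballP[e /= e0 eU].
have [x [y /andP[xy0 xye]]] := small _ e0.
exists (mdist x y); split; first by rewrite gt_eqF.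
  by exists (x, y).
apply: eU; first by rewrite /ball /= sub0r normrN gtr0_norm.
by rewrite /= in_itv /= mdist_ge0.
Unshelve. all: by end_near. Qed.

Lemma unif_continuous_mdistP (R : realType) (X Y : metricType R) (F : X -> Y) :
  unif_continuous F <->
  forall e : R, 0 < e -> exists2 d : R, 0 < d &
    forall x y : X, mdist x y < d -> mdist (F x) (F y) < e.
Proof.
split=> [uF e e0|uF A].
  have /uF : entourage [set p : Y * Y | ball p.1 e p.2].
    exact: entourage_ball (PosNum e0).
  rewrite /nbhs /= -entourage_ballE => -[d /= d0 dF]; exists d => // x y xyd.
  by have := dF (x, y); rewrite /= !ballEmdist; apply.
rewrite /nbhs /= -!entourage_ballE => -[e /= e0 eA].
have [d d0 dF] := uF _ e0.
exists d => // -[x y] /=; rewrite ballEmdist /= => xyd.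
by apply: eA; rewrite /= ballEmdist; exact: dF.
Qed.

Lemma unif_continuous_ac (R : realType) (X Y : metricType R) (F : X -> Y) :
  injective F -> unif_continuous F ->
  ac (distance_set X) 0 -> ac (distance_set Y) 0.
Proof.
move=> Finj /unif_continuous_mdistP uF /ac_distance_set0P acX.
apply/ac_distance_set0P => e e0.
have [d d0 dF] := uF _ e0.
have [x [y /andP[xy0 xyd]]] := acX _ d0.
exists (F x), (F y); rewrite dF // andbT mdist_gt0 (inj_eq Finj).
by rewrite -mdist_gt0.
Qed.

(** Only surjectivity and order preservation are assumed, so that this serves both [Phi] and its
    inverse. *)
Lemma ac_unif_continuous (R : realType) (X Y : metricType R) (F : X -> Y) :
  set_surj [set: X] [set: Y] F ->
  (forall x y x' y' : X,
    mdist x y < mdist x' y' -> mdist (F x) (F y) < mdist (F x') (F y')) ->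
  (ac (distance_set X) 0 -> ac (distance_set Y) 0) ->
  unif_continuous F.
Proof.
move=> Fsurj Fmono acXY; apply/unif_continuous_mdistP => e e0.
have [/acXY/ac_distance_set0P acY|] := pselect (ac (distance_set X) 0).
  have [u [v /andP[uv0 uve]]] := acY _ e0.
  have [[x _ xu] [y _ yv]] := (Fsurj u I, Fsurj v I); subst u v.
  exists (mdist x y) => [|a b /Fmono /lt_trans]; last exact.
  by rewrite mdist_gt0; apply: contraTneq uv0 => ->; rewrite mdistxx ltxx.
(* No distance lies strictly between 0 and [d], so points closer than [d] coincide. *)
move/ac_distance_set0P/existsNP => [d /not_implyP[d0 isolated]].
exists d => // x y xyd; suff -> : x = y by rewrite mdistxx.
apply/eqP; apply: contra_notT isolated => xy.
by exists x, y; rewrite mdist_gt0 xy.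
Qed.

(** A strictly increasing function on a totally ordered set also reflects the order. *)
Lemma weak_similarity_mono (R : realType) (X Y : metricType R) (F : X -> Y) :
  weak_similarity F -> forall x y x' y' : X,
  (mdist x y < mdist x' y') = (mdist (F x) (F y) < mdist (F x') (F y')).
Proof.
move=> [_ [f [_ fmono fE]]] x y x' y'.
have inD (u v : Y) : mdist u v \in distance_set Y by rewrite inE; exists (u, v).
by rewrite (fE x) (fE x') (leW_mono_in (le_mono_in fmono)) ?inD.
Qed.

Lemma weak_similarity_inj (R : realType) (X Y : metricType R) (F : X -> Y) :
  weak_similarity F -> injective F.
Proof.
move=> [_ [f [_ _ fE]]] x y Fxy; apply: mdist_positivity.
(* Here [f] is evaluated at the distance from [F y] to itself, where its value is the distance from
   [y] to itself. *)
by rewrite fE Fxy -fE mdistxx.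
Qed.

Theorem corollary2p3 (R : realType) (X Y : metricType R)
    (hX : [set: X] !=set0) (hY : [set: Y] !=set0)
    (Phi : X -> Y) (hPhi : weak_similarity Phi) :
  uniform_equivalence Phi <->
  (ac (distance_set X) 0 <-> ac (distance_set Y) 0).
Proof.
have [Psurj _] := hPhi; have Pinj := weak_similarity_inj hPhi.
have Pmono := weak_similarity_mono hPhi.
split=> [[uP [G [PK GK uG]]]|[acXY acYX]].
  split; first exact: unif_continuous_ac uP.
  exact: unif_continuous_ac (can_inj GK) uG.
split.
  by apply: ac_unif_continuous acXY => // x y x' y'; rewrite Pmono.
(* Surjectivity gives a right inverse, which injectivity makes two-sided. *)
have /choice[G GK] : forall y, exists x, Phi x = y.
  by move=> y; have [x _ <-] := Psurj y I; exists x.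
have PK : cancel Phi G by move=> x; apply: Pinj; rewrite GK.
exists G; split=> //; apply: ac_unif_continuous acYX.
  by move=> x _; exists (Phi x); rewrite ?PK.
(* Since [Phi] reflects the order of distances, [G] preserves it. *)
by move=> x y x' y'; rewrite Pmono !GK.
Qed.
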